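(* Let $d\geqslant 5$ be an odd integer and let $n$ be a positive integer with $n\equiv -\frac{1}{2}\pmod{d}$. Then, modulo $\Phi_n(q)(1-aq^n)(a-q^n)$, $$\sum_{k=0}^{n-1}[2dk+1]\frac{(a^{d-2}q, a^{d-4}q,\ldots, aq;q^d)_k\,(a^{2-d}q, a^{4-d}q,\ldots, a^{-1}q;q^d)_k\, (q;q^d)_k}{(a^{d-2}q^d, a^{d-4}q^d,\ldots,aq^d;q^d)_k\,(a^{2-d}q^d, a^{4-d}q^d,\ldots,a^{-1}q^d;q^d)_k\, (q^d;q^d)_k}\, q^{\frac{d(d-3)k}{2}}\equiv 0.$$
   Context: Here $q$ and $a$ are independent indeterminates. Notation: $(x;q)_k=(1-x)(1-xq)\cdots(1-xq^{k-1})$ for $k\ge 1$, $(x;q)_0=1$, and $(x_1,\ldots,x_m;q)_k=(x_1;q)_k\cdots(x_m;q)_k$ (so $(x;q^d)_k=\prod_{i=0}^{k-1}(1-xq^{di})$). For an integer $m$, $[m]=\frac{1-q^m}{1-q}$. $\Phi_n(q)$ is the $n$-th cyclotomic polynomial in $q$. The condition $n\equiv -\frac12\pmod d$ (with $d$ odd) means $2n\equiv -1\pmod d$. In each list the exponents of $a$ change in steps of $2$: in both numerator and denominator the exponents of $a$ are $\pm1,\pm3,\ldots,\pm(d-2)$ and $0$. For a rational function $A(a,q)$ and a polynomial $P(a,q)$, $A\equiv 0$ modulo $P$ means that $A=PU/V$ with polynomials $U,V$ in $a,q$ (over $\mathbb{Q}$), where $V$ is relatively prime to $P$. *)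

(* Defs.v *)
From mathcomp Require Import all_boot all_order all_algebra all_field.

Set Implicit Arguments.
Unset Strict Implicit.
Unset Printing Implicit Defensive.

Import GRing.Theory.
Local Open Scope ring_scope.

(* Q[a, q] is represented as Q[q][a]: the outer variable is a. *)
Definition polyaq : idomainType := {poly {poly rat}}.
Definition ratfunaq : fieldType := {fraction polyaq}.

Definition polya : polyaq := 'X.
Definition polyq : polyaq := ('X : {poly rat})%:P.

Definition polyPhi (n : nat) : polyaq :=
  (map_poly (intr : int -> rat) 'Phi_n)%:P.

Definition inda : ratfunaq := FracField.tofrac polya.
Definition indq : ratfunaq := FracField.tofrac polyq.

(* [coprimep] is not suitable in the next definition: over the integral domain
   {poly rat} it ignores common factors that do not involve a. *)
Definition dvdaq (D P : polyaq) : Prop := exists C : polyaq, P = D * C.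

Definition relprimeaq (P V : polyaq) : Prop :=
  forall D : polyaq, dvdaq D P -> dvdaq D V -> D \is a GRing.unit.

Definition congr0aq (A : ratfunaq) (P : polyaq) : Prop :=
  exists U V : polyaq,
    [/\ V != 0, relprimeaq P V
      & A = FracField.tofrac (P * U) / FracField.tofrac V].

Section QNotation.
Variable F : fieldType.

Definition qpoch (x q : F) (k : nat) : F := \prod_(i < k) (1 - x * q ^+ i).

Definition qpochs (xs : seq F) (q : F) (k : nat) : F :=
  \prod_(x <- xs) qpoch x q k.

Definition qint (q : F) (m : int) : F := (1 - q ^ m) / (1 - q).

(* For d odd, as j runs over 0, ..., (d-1)/2 - 1 the exponent d - 2 - 2j runs
   over d-2, d-4, ..., 1, so the truncated subtraction never truncates. *)
Definition pospows (d : nat) (a x : F) : seq F :=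
  [seq a ^+ (d - 2 - 2 * j) * x | j <- iota 0 (d.-1)./2].

Definition negpows (d : nat) (a x : F) : seq F :=
  [seq a ^- (d - 2 - 2 * j) * x | j <- iota 0 (d.-1)./2].

End QNotation.

(* Main.v *)
Require Import Defs.
From mathcomp Require Import all_boot all_order all_algebra all_field.
From mathcomp Require Import zify ring.
Set Implicit Arguments.
Unset Strict Implicit.
Unset Printing Implicit Defensive.
Import GRing.Theory.
Local Open Scope ring_scope.

(** Put d = 2h + 1 and Q = q^d. The hypothesis on n reads n = r d + h for some
    r, and then N = ((d - 2) n - 1) / d is an integer smaller than n. The summand
    is a very-well-poised term of base Q: it is the product of
    (1 - q Q^(2k)) / (1 - q), of a power of Q^k, and of one factor
    (x q; Q)_k / (Q / x; Q)_k for each x in 1, a^(+-1), a^(+-3), ..., a^(+-(d-2))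
    (summandE).

    Each of the three factors of the modulus is a prime of Q[q, a], and it is the
    kernel of the evaluation at a generic zero of that factor: a = t and q a
    primitive n-th root of unity; a = t^(-n) and q = t; a = t^n and q = t, where t
    is transcendental (dvdaq_cyclotomic, dvdaq_inverse_power, dvdaq_power). None
    of the denominators vanishes at these zeros. Hence the congruence amounts to
    the vanishing of the sum at the three of them.

    At a primitive n-th root of unity q Q^N = 1, so that the terms with k > N
    vanish and the k-th term is the opposite of the (N - k)-th (wpterm_rev).

    At a = t^n one has a^2 q = Q^(2r+1) and a^(d-2) = q Q^N. The factor of
    x = a^(-(d-2)) makes the series stop at N, and the other factors can be
    matched, a^j with a^(2-j), so that each match is, up to a power of Q^k, a
    polynomial of degree 2r in the quantity x_k = Q^(-k) + q Q^k (the factor of a,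
    matched with itself, has degree r). What is left is, up to a constant and a
    power of Q^k, the reciprocal of the product of the differences x_k - x_j
    (node_prod), and the powers of Q^k cancel. The sum is therefore a
    divided difference of order N of a polynomial of degree N - (h - 1) < N, and
    vanishes (sum_sympoly_eq0). The condition d >= 5 is exactly h - 1 > 0. The
    case a = t^(-n) follows from the symmetry of the sum in a and 1/a. *)

Local Notation "p %:F" := (FracField.tofrac p) (at level 1, format "p %:F").

(** * Well-poised terms and their reversal at a root of unity *)

Section WellPoised.
Variable K : fieldType.
Implicit Types (a q Q x b c : K) (h n N k i s : nat).

Definition summand (d : nat) a q k : K :=
  qint q (2 * d * k + 1)%N%:Z *
  ((qpochs (pospows d a q) (q ^+ d) k *
    qpochs (negpows d a q) (q ^+ d) k *
    qpoch q (q ^+ d) k) /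
   (qpochs (pospows d a (q ^+ d)) (q ^+ d) k *
    qpochs (negpows d a (q ^+ d)) (q ^+ d) k *
    qpoch (q ^+ d) (q ^+ d) k)) *
  q ^+ (d * (d - 3) * k)./2.

(** The parameters of numerator and denominator multiply to q Q: this is the
    well-poised condition, and it is what relates the factor to its image under
    the reflection Q^k -> 1 / (q Q^k). *)
Definition wpfac q Q x k : K := qpoch (x * q) Q k / qpoch (x^-1 * Q) Q k.

Definition wpprod h a q Q k : K :=
  \prod_(i < h) (wpfac q Q (a ^+ (2 * i).+1) k * wpfac q Q (a ^- (2 * i).+1) k).

Definition wpterm h a q Q k : K :=
  (1 - q * Q ^+ (2 * k)) / (1 - q) * wpfac q Q 1 k * wpprod h a q Q k
    * Q ^+ (h.-1 * k).

Lemma qpochS x Q k : qpoch x Q k.+1 = qpoch x Q k * (1 - x * Q ^+ k).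
Proof. by rewrite /qpoch big_ord_recr. Qed.

Lemma qpoch0 x Q : qpoch x Q 0 = 1.
Proof. by rewrite /qpoch big_ord0. Qed.

Lemma qpochD x Q k s : qpoch x Q (k + s) = qpoch x Q k * qpoch (x * Q ^+ k) Q s.
Proof.
by rewrite /qpoch big_split_ord; congr (_ * _); apply: eq_bigr => i _;
  rewrite /= exprD mulrA.
Qed.

Lemma qpoch_neq0 x Q k :
  (forall s, (s < k)%N -> x * Q ^+ s != 1) -> qpoch x Q k != 0.
Proof.
move=> H; apply/prodf_neq0 => i _.
by rewrite subr_eq0 eq_sym H.
Qed.

Lemma qpoch_eq0 x Q N k : x * Q ^+ N = 1 -> (N < k)%N -> qpoch x Q k = 0.
Proof.
by move=> H lt; rewrite /qpoch (bigD1 (Ordinal lt)) //= H subrr mul0r.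
Qed.

Lemma big_pospows h a x (F : K -> K) :
  \prod_(y <- pospows h.*2.+1 a x) F y = \prod_(i < h) F (a ^+ (2 * i).+1 * x).
Proof.
have -> : pospows h.*2.+1 a x =
    [seq a ^+ (h.*2.+1 - 2 - 2 * j) * x | j <- index_iota 0 h].
  by rewrite /pospows /index_iota subn0 doubleK.
rewrite big_map big_nat_rev big_mkord.
apply: eq_bigr => i _; congr (F (_ ^+ _ * _)).
by have := ltn_ord i; lia.
Qed.

Lemma big_negpows h a x (F : K -> K) :
  \prod_(y <- negpows h.*2.+1 a x) F y = \prod_(i < h) F (a ^- (2 * i).+1 * x).
Proof.
have -> : negpows h.*2.+1 a x = pospows h.*2.+1 a^-1 x.
  by apply: eq_map => i; rewrite exprVn.
by rewrite big_pospows; apply: eq_bigr => i _; rewrite exprVn.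
Qed.

Lemma summandE h a q k : (0 < h)%N ->
  summand h.*2.+1 a q k = wpterm h a q (q ^+ h.*2.+1) k.
Proof.
move=> h_gt0; rewrite /summand /wpterm /qpochs !big_pospows !big_negpows.
set Q := q ^+ h.*2.+1.
have -> : q ^+ (h.*2.+1 * (h.*2.+1 - 3) * k)./2 = Q ^+ (h.-1 * k).
  rewrite /Q -exprM; congr (_ ^+ _).
  have -> : (h.*2.+1 - 3 = (h.-1).*2)%N by lia.
  by rewrite -[X in (X * k)%N]doubleMr -doubleMl doubleK mulnA.
have -> : qint q (2 * h.*2.+1 * k + 1)%N%:Z = (1 - q * Q ^+ (2 * k)) / (1 - q).
  rewrite /qint; congr ((1 - _) / _).
  by rewrite -exprnP /Q -exprM -exprS; congr (_ ^+ _); lia.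
congr (_ * _); rewrite -[RHS]mulrA; congr (_ * _).
have -> : wpprod h a q Q k = \prod_(i < h)
    (qpoch (a ^+ (2 * i).+1 * q) Q k * qpoch (a ^- (2 * i).+1 * q) Q k /
    (qpoch (a ^+ (2 * i).+1 * Q) Q k * qpoch (a ^- (2 * i).+1 * Q) Q k)).
  by apply: eq_bigr => i _; rewrite /wpfac invrK invfM; ring.
by rewrite prodf_div !big_split /wpfac mul1r invr1 mul1r !invfM /=; ring.
Qed.

Section Reversal.
Variables (q Q : K) (N : nat).
Hypotheses (Q_neq0 : Q != 0) (qQN : q * Q ^+ N = 1).

(** As q Q^N = 1, the number 1 - x q Q^(N-k-1) is a monomial multiple of
    1 - Q^(k+1) / x: the reversal k -> N - k exchanges the factors of the numerator
    with those of the denominator, and the monomials add up to a geometric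
    progression in k. *)
Lemma wpfac_rev x k :
    x != 0 -> (forall s, (0 < s <= N)%N -> x^-1 * Q ^+ s != 1) -> (k <= N)%N ->
  wpfac q Q x (N - k) = wpfac q Q x N * (Q / (q * x ^+ 2)) ^+ k * wpfac q Q x k.
Proof.
move=> x_neq0 ndeg; elim: k => [|k IHk] lekN.
  by rewrite subn0 expr0 /wpfac !qpoch0 divr1 !mulr1.
have q_neq0 : q != 0 by apply: contra_eq_neq qQN => ->; rewrite mul0r eq_sym oner_eq0.
have {}IHk := IHk (ltnW lekN).
have Qk : Q ^+ (N - k.+1) = (q * Q ^+ k.+1)^-1.
  apply/eqP; rewrite eq_sym -(inj_eq (mulfI (_ : q * Q ^+ k.+1 != 0)));
    last by rewrite mulf_neq0 ?expf_neq0.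
  by rewrite mulfV ?mulf_neq0 ?expf_neq0 // -mulrA -exprD subnKC // qQN.
have ndeg_k : x^-1 * Q ^+ k.+1 != 1 by apply: ndeg.
have ndeg_Nk : x^-1 * Q * Q ^+ (N - k.+1) != 1.
  by rewrite -mulrA -exprS; apply: ndeg; lia.
have nz_num : 1 - x * q * Q ^+ (N - k.+1) != 0.
  rewrite Qk (_ : x * q / _ = (x^-1 * Q ^+ k.+1)^-1).
    by rewrite subr_eq0 eq_sym invr_eq1.
  by field; rewrite ?expf_neq0 ?x_neq0 ?q_neq0.
have step : wpfac q Q x (N - k) = wpfac q Q x (N - k.+1) *
    ((1 - x * q * Q ^+ (N - k.+1)) / (1 - x^-1 * Q * Q ^+ (N - k.+1))).
  rewrite /wpfac (_ : (N - k = (N - k.+1).+1)%N); last by lia.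
  by rewrite !qpochS mulf_div.
have {}step : wpfac q Q x (N - k.+1) = wpfac q Q x (N - k) *
    ((1 - x^-1 * Q * Q ^+ (N - k.+1)) / (1 - x * q * Q ^+ (N - k.+1))).
  by rewrite step -[in RHS]mulrA mulf_div [X in _ / X]mulrC divff ?mulr1 //
       mulf_neq0 // subr_eq0 eq_sym.
have stepk : wpfac q Q x k.+1 = wpfac q Q x k *
    ((1 - x * q * Q ^+ k) / (1 - x^-1 * Q * Q ^+ k)).
  by rewrite /wpfac !qpochS mulf_div.
rewrite step IHk [(_ / _) ^+ _.+1]exprS stepk.
set c := wpfac q Q x N; set e := (_ / _) ^+ k; set f := wpfac q Q x k.
rewrite [RHS](_ : _ = c * e * f * (Q / (q * x ^+ 2) *
   ((1 - x * q * Q ^+ k) / (1 - x^-1 * Q * Q ^+ k)))); last by ring.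
congr (_ * _).
move: nz_num; rewrite Qk exprS => nz_num.
move: ndeg_k; rewrite exprS eq_sym -subr_eq0 => ndeg_k.
have Qk_neq0 : Q ^+ k != 0 by rewrite expf_neq0.
have x_neq_Qk : x != Q * Q ^+ k.
  by apply: contraNneq ndeg_k => <-; rewrite mulVf // subrr.
field; rewrite !subr_eq0 x_neq0 q_neq0 Q_neq0 Qk_neq0 x_neq_Qk.
by rewrite eq_sym x_neq_Qk.
Qed.

(** Read backwards, the factors of the numerator are monomial multiples of
    those of the denominator. *)
Lemma wpfac_last x :
    x != 0 -> (forall s, (0 < s <= N)%N -> x^-1 * Q ^+ s != 1) ->
  wpfac q Q x N = (- x) ^+ N / Q ^+ 'C(N.+1, 2).
Proof.
move=> x_neq0 ndeg; apply: canLR (mulfK _) _.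
  by apply: qpoch_neq0 => s ltsN; rewrite -mulrA -exprS ndeg.
rewrite -bin2_sum big_nat_recl // add0n big_mkord -prodrXr.
rewrite {1}/qpoch (reindex_inj rev_ord_inj) /=.
rewrite -[N in _ ^+ N](card_ord N) -prodr_const -prodf_div -big_split /=.
apply: eq_bigr => i _.
have qQi : q * Q ^+ (N - i.+1) = (Q ^+ i.+1)^-1.
  apply: (mulIf (_ : Q ^+ i.+1 != 0)); first by rewrite expf_neq0.
  by rewrite mulVf ?expf_neq0 // -mulrA -exprD subnK.
by rewrite -mulrA qQi exprS; field; rewrite x_neq0 Q_neq0 expf_neq0.
Qed.

(** For x and 1/x together the powers of x cancel. *)
Lemma wpfac_pair_rev x k :
    x != 0 -> (forall s, (0 < s <= N)%N -> x^-1 * Q ^+ s != 1) ->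
    (forall s, (0 < s <= N)%N -> x * Q ^+ s != 1) -> (k <= N)%N ->
  wpfac q Q x (N - k) * wpfac q Q x^-1 (N - k) =
  (Q ^+ 'C(N.+1, 2)) ^- 2 * (Q / q) ^+ (2 * k) *
    (wpfac q Q x k * wpfac q Q x^-1 k).
Proof.
move=> x_neq0 ndeg ndegV lekN.
have xV_neq0 : x^-1 != 0 by rewrite invr_eq0.
have q_neq0 : q != 0.
  by apply: contra_eq_neq qQN => ->; rewrite mul0r eq_sym oner_eq0.
rewrite !wpfac_rev ?invrK // !wpfac_last ?invrK //.
set E := Q ^+ _; set R := wpfac q Q x k; set R' := wpfac q Q x^-1 k.
have eN : (- x) ^+ N * (- x^-1) ^+ N = 1.
  by rewrite -exprMn mulrNN divff // expr1n.
have ek : (Q / (q * x ^+ 2)) ^+ k * (Q / (q * x^-1 ^+ 2)) ^+ k = (Q / q) ^+ (2 * k).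
  by rewrite -exprMn exprM; congr (_ ^+ _); field; rewrite x_neq0 q_neq0.
rewrite -ek -[RHS]mul1r -eN.
set u := (- x) ^+ N; set v := (- x^-1) ^+ N.
set w := (Q / (q * x ^+ 2)) ^+ k; set w' := (Q / (q * x^-1 ^+ 2)) ^+ k.
by field; rewrite expf_neq0.
Qed.

End Reversal.

(** Under this condition none of the denominators of the terms with k < n
    vanishes. *)
Definition generic h n a q Q :=
  [/\ a != 0, q != 0, q != 1, (forall s, (0 < s < n)%N -> Q ^+ s != 1)
    & forall i s, (i < h)%N -> (0 < s < n)%N ->
        (a ^+ (2 * i).+1 * Q ^+ s != 1) && (a ^- (2 * i).+1 * Q ^+ s != 1)].

Lemma prim_root_half n q : n.-primitive_root q -> ~~ odd n -> q ^+ n./2 = -1.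
Proof.
move=> prim_q even_n; have n_gt0 := prim_order_gt0 prim_q.
have : q ^+ n./2 ^+ 2 == 1.
  by rewrite -exprM muln2 even_halfK // (prim_expr_order prim_q).
rewrite sqrf_eq1 => /orP[|/eqP//].
by rewrite -(prim_order_dvd prim_q) => /dvdn_leq; lia.
Qed.

(** The reversal of each factor costs a geometric progression in k and a
    constant. The progressions cancel against the power of Q and the factor
    1 - q Q^(2k), which supplies the sign. The constants multiply to a sign times
    a power of q that has to be evaluated exactly: it involves q to half a
    multiple of n, which is -1 precisely when N is odd. *)
Lemma wpterm_rev h n N a q k :
    (0 < h)%N -> (h.*2.+1 * N + 1 = (h.*2 - 1) * n)%N -> (N < n)%N -> (k <= N)%N ->
    n.-primitive_root q -> generic h n a q (q ^+ h.*2.+1) ->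
  wpterm h a q (q ^+ h.*2.+1) (N - k) = - wpterm h a q (q ^+ h.*2.+1) k.
Proof.
move=> h_gt0 defN ltNn lekN prim_q [a_neq0 q_neq0 q_neq1 ndegQ ndega].
set Q := q ^+ h.*2.+1 in ndegQ ndega *.
have Q_neq0 : Q != 0 by rewrite expf_neq0.
have qQN : q * Q ^+ N = 1.
  rewrite -exprM -exprS -addn1 defN mulnC exprM.
  by rewrite (prim_expr_order prim_q) expr1n.
set E := Q ^+ 'C(N.+1, 2).
have E_neq0 : E != 0 by rewrite expf_neq0.
have ndegaN i s : (0 < s <= N)%N -> (i < h)%N ->
    (a ^- (2 * i).+1 * Q ^+ s != 1) && (a ^+ (2 * i).+1 * Q ^+ s != 1).
  by move=> /andP[s_gt0 lesN] lti; rewrite andbC ndega // s_gt0 (leq_ltn_trans lesN).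
have prodE : wpprod h a q Q (N - k) =
    (E ^- 2 * (Q / q) ^+ (2 * k)) ^+ h * wpprod h a q Q k.
  have -> : (E ^- 2 * (Q / q) ^+ (2 * k)) ^+ h =
      \prod_(i < h) (E ^- 2 * (Q / q) ^+ (2 * k)) by rewrite prodr_const card_ord.
  rewrite /wpprod -big_split /=.
  apply: eq_bigr => i _; apply: (wpfac_pair_rev Q_neq0 qQN) => //.
  - by rewrite expf_neq0.
  - by move=> s /ndegaN /(_ (ltn_ord i)) /andP[].
  - by move=> s /ndegaN /(_ (ltn_ord i)) /andP[].
have facE : wpfac q Q 1 (N - k) = (-1) ^+ N / E * (Q / q) ^+ k * wpfac q Q 1 k.
  have ndeg1 s : (0 < s <= N)%N -> 1^-1 * Q ^+ s != 1.
    by move=> ltsN; rewrite invr1 mul1r ndegQ //; lia.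
  by rewrite (wpfac_rev Q_neq0 qQN) ?oner_neq0 // (wpfac_last Q_neq0 qQN) ?oner_neq0 //
    expr1n mulr1.
have EqX : E = q ^+ (h.*2.+1 * 'C(N.+1, 2)) by rewrite exprM.
have binE : (2 * (h.*2.+1 * 'C(N.+1, 2)) = (h.*2 - 1) * n * N + 2 * (N * h))%N.
  have := mul_bin_diag N.+1 1; rewrite bin1 /= => bin2E.
  by rewrite mulnCA -bin2E -defN; lia.
have sgnE : E = (-1) ^+ N * q ^+ (N * h).
  rewrite EqX; have [N_odd|N_even] := boolP (odd N).
    have n_even : ~~ odd n.
      have := congr1 odd defN; rewrite oddD !oddM N_odd /= odd_double /=.
      by rewrite oddB ?odd_double //; lia.
    have -> : (h.*2.+1 * 'C(N.+1, 2) = n./2 * ((h.*2 - 1) * N) + N * h)%N.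
      move: binE; rewrite -{1}(even_halfK n_even); move: (h.*2 - 1)%N => m; lia.
    rewrite exprD exprM prim_root_half //.
    rewrite -[in LHS]signr_odd -[in RHS]signr_odd oddM N_odd andbT.
    by rewrite oddB ?odd_double //; lia.
  have -> : (h.*2.+1 * 'C(N.+1, 2) = n * ((h.*2 - 1) * N./2) + N * h)%N.
    move: binE; rewrite -{3}(even_halfK N_even); move: (h.*2 - 1)%N => m; lia.
  rewrite exprD exprM (prim_expr_order prim_q) expr1n.
  by rewrite -[in RHS]signr_odd (negPf N_even).
have E2 : E ^+ 2 * q ^+ N.+1 = 1.
  rewrite sgnE exprMn sqrr_sign mul1r -exprM -exprD.
  have -> : (N * h * 2 + N.+1 = n * (h.*2 - 1))%N by rewrite [RHS]mulnC -defN; lia.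
  by rewrite exprM (prim_expr_order prim_q) expr1n.
have cst : (-1) ^+ N / E * E ^- 2 ^+ h = q ^+ h.
  have -> : E ^- 2 = q ^+ N.+1.
    by apply: (mulfI (_ : E ^+ 2 != 0)); rewrite ?expf_neq0 // mulfV ?E2 ?expf_neq0.
  rewrite sgnE -exprM mulSn exprD (mulnC N h).
  by field; rewrite signr_eq0 expf_neq0.
have QNk : Q ^+ (N - k) = (q * Q ^+ k)^-1.
  apply: (mulIf (_ : q * Q ^+ k != 0)); first by rewrite mulf_neq0 ?expf_neq0.
  by rewrite mulVf ?mulf_neq0 ?expf_neq0 // mulrCA -exprD subnK.
rewrite /wpterm prodE facE [(E ^- 2 * _) ^+ h]exprMn.
rewrite mulnC (mulnC h.-1 (N - k)%N) (mulnC 2 k) (mulnC h.-1 k) !exprM QNk.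
(* With y = q^k and z = Q^k = y^d all that remains is rational in y, z and
   their powers of exponent h - 1. *)
have zE : Q ^+ k = (q ^+ k) ^+ h.-1 ^+ 2 * (q ^+ k) ^+ 3.
  rewrite /Q -!exprM -exprD; congr (_ ^+ _); nia.
rewrite !expr_div_n.
have y_neq0 : q ^+ k != 0 by rewrite expf_neq0.
have z_neq0 : Q ^+ k != 0 by rewrite expf_neq0.
have sqrX (b : K) : (b ^+ 2) ^+ h = b ^+ 2 * (b ^+ h.-1) ^+ 2.
  by rewrite -{1}(prednK h_gt0) [LHS]exprS [X in _ * X]exprAC.
have qzX : (q * Q ^+ k)^-1 ^+ h.-1 = (q ^+ h.-1 * Q ^+ k ^+ h.-1)^-1.
  by rewrite exprVn exprMn.
rewrite !sqrX qzX.
have : q ^+ h = q * q ^+ h.-1 by rewrite -exprS prednK.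
have : Q ^+ k ^+ h.-1 != 0 by rewrite expf_neq0.
have : q ^+ k ^+ h.-1 != 0 by rewrite expf_neq0.
have : q ^+ h.-1 != 0 by rewrite expf_neq0.
have : 1 - q != 0 by rewrite subr_eq0 eq_sym.
move: y_neq0 q_neq0 z_neq0 zE cst.
move: (q ^+ h) (q ^+ h.-1) (Q ^+ k ^+ h.-1) (q ^+ k ^+ h.-1) => qh1 qh zh yh.
move: (Q ^+ k) (q ^+ k) => z y.
move: (E ^- 2 ^+ h) ((-1) ^+ N / E) (wpfac q Q 1 k) (wpprod h a q Q k).
move=> u v w P y0 q0 z0 zE cst nq nqh nyh nzh qh1E.
have y3 : y ^+ 3 = z / yh ^+ 2 by rewrite zE; field.
transitivity (v * u * ((1 - q * (q * z)^-1 ^+ 2) / (1 - q) *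
    (z ^+ 3 * zh / (y ^+ 3 * yh ^+ 2)) / qh) * (w * P)).
  by field; rewrite nq nqh nyh nzh y0 q0 z0.
have {}cst : v * u = q * qh by rewrite -qh1E.
by rewrite cst y3; field; rewrite ?nq ?nqh ?nyh ?q0 ?z0.
Qed.

Lemma wpterm_eq0 h a q Q k : qpoch q Q k = 0 -> wpterm h a q Q k = 0.
Proof. by move=> q0; rewrite /wpterm /wpfac mul1r q0 mul0r mulr0 !mul0r. Qed.

(** The factor (q; Q)_k kills the terms beyond N; the others cancel in pairs,
    or, for the middle one, with themselves. *)
Lemma sum_wpterm_prim_root h n N a q :
    (2 != 0 :> K) ->
    (0 < h)%N -> (h.*2.+1 * N + 1 = (h.*2 - 1) * n)%N -> (N < n)%N ->
    n.-primitive_root q -> generic h n a q (q ^+ h.*2.+1) ->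
  \sum_(0 <= k < n) wpterm h a q (q ^+ h.*2.+1) k = 0.
Proof.
move=> nz2 h_gt0 defN ltNn prim_q gen.
have qQN : q * q ^+ h.*2.+1 ^+ N = 1.
  rewrite -exprM -exprS -addn1 defN mulnC exprM.
  by rewrite (prim_expr_order prim_q) expr1n.
have tail0 : \sum_(N.+1 <= k < n) wpterm h a q (q ^+ h.*2.+1) k = 0.
  rewrite big_nat big1 // => k /andP[ltNk _].
  exact/wpterm_eq0/(qpoch_eq0 qQN).
rewrite (big_cat_nat (n := N.+1)) //= tail0 addr0.
(* The sum equals its own opposite. *)
apply: (mulfI nz2); rewrite mulr0 mulr_natl mulr2n {1}big_nat_rev -big_split /=.
rewrite big_nat big1 // => k /andP[_ ltkN].
by rewrite add0n subSS (wpterm_rev (N := N) (n := n)) // addNr.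
Qed.

End WellPoised.

(** * Terminating series and divided differences *)

Section Terminating.
Variable K : fieldType.
Implicit Types (a q Q x b c : K) (h n N k i s r : nat).

Section Nodes.
Variables A Q : K.
Hypothesis Q_neq0 : Q != 0.

(** In terms of z = Q^k, the nodes are the values of z^-1 + A z, the simplest
    function that is invariant under the well-poised reflection z -> 1 / (A z). *)
Definition node k : K := Q ^- k + A * Q ^+ k.

Lemma nodeB j s : node (j + s) - node j =
  Q ^- (j + s) * ((1 - Q ^+ s) * (1 - A * Q ^+ (j + (j + s)))).
Proof.
by rewrite /node !exprD; field; rewrite !expf_neq0.
Qed.

Lemma node_inj :
    (forall s, (0 < s)%N -> Q ^+ s != 1) ->
    (forall s, A * Q ^+ s != 1) ->
  injective node.
Proof.
move=> nQ nA; suff lt_neq i j : (i < j)%N -> node i != node j.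
  move=> i j eq_ij; apply/eqP; rewrite eqn_leq.
  by apply/andP; split; rewrite leqNgt; apply/negP=> /lt_neq; rewrite eq_ij eqxx.
move=> ltij; rewrite -(subnKC (ltnW ltij)) eq_sym -subr_eq0 nodeB.
rewrite !mulf_neq0 ?invr_eq0 ?expf_neq0 // subr_eq0 eq_sym ?nA //.
by rewrite nQ // subn_gt0.
Qed.

(** Compare the coefficients of degree N in the Lagrange interpolation formula
    for p at the N + 1 points x 0, ..., x N. *)
Lemma sum_divided_difference (x : nat -> K) N (p : {poly K}) :
    injective x -> (size p <= N)%N ->
  \sum_(k < N.+1) p.[x k] / \prod_(j < N.+1 | j != k) (x k - x j) = 0.
Proof.
move=> x_inj sz_p; have p_N0 : p`_N = 0 by rewrite nth_default.
rewrite -[RHS]p_N0 [in RHS](lagrange_gen (ltn0Sn N) x_inj (leqW sz_p)) coef_sum.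
apply: eq_bigr => k _; rewrite coefCM; congr (_ * _).
have <- : lead_coef (tnth (lagrange N.+1 x) k) = (tnth (lagrange N.+1 x) k)`_N.
  by rewrite lead_coefE size_lagrange_.
rewrite lagrangeE // lead_coefM lead_coefC.
rewrite (monicP (monic_prod _ _)) => [|j _]; last exact: monicXsubC.
rewrite mulr1 horner_prod; congr (_^-1).
by apply: eq_bigr => j _; rewrite hornerXsubC.
Qed.

Lemma prod_neq_ord (F : nat -> K) N k : (k <= N)%N ->
  \prod_(j < N.+1 | j != k :> nat) F j =
  \prod_(j < k) F j * \prod_(j < N - k) F (k.+1 + j)%N.
Proof.
move=> lekN; rewrite -(big_mkord (fun j => j != k)) (big_cat_nat (n := k)) //=;
  last exact: leqW.
congr (_ * _).
  rewrite -[RHS](big_mkord xpredT F) big_nat_cond [RHS]big_nat_cond.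
  by apply: eq_bigl => j; lia.
rewrite big_ltn_cond // eqxx /= -{1}[k.+1]add0n big_addn subSS big_mkord.
by apply: eq_big => [j|j _]; rewrite addnC //; lia.
Qed.

(** The factors 1 - Q^(N-i) that (Q; Q)_N has in excess of (Q; Q)_(N-k) are,
    up to monomials, those of (Q^-N; Q)_k. *)
Lemma qpoch_compl N k : (k <= N)%N ->
  qpoch Q Q (N - k) * qpoch (Q ^- N) Q k *
    (Q ^+ (k * (N - k)) * \prod_(k <= j < N) (- Q ^- j.+1)) =
  qpoch Q Q N * \prod_(0 <= j < N) (- Q ^- j.+1).
Proof.
elim: k => [|k IHk] lekN; first by rewrite subn0 qpoch0 mul0n mulr1 mul1r.
rewrite -{}IHk 1?ltnW // [in RHS]big_ltn // qpochS.
have -> : (N - k = (N - k.+1).+1)%N by lia.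
rewrite qpochS -exprS.
set P := \prod_(_ <= _ < _) _; set e := (N - k.+1)%N.
have -> : Q ^+ (k.+1 * e) = Q ^+ (k * e) * Q ^+ e by rewrite -exprD mulSn addnC.
have -> : Q ^+ (k * e.+1) = Q ^+ (k * e) * Q ^+ k by rewrite -exprD mulnS addnC.
have -> : Q ^+ N = Q ^+ k * Q * Q ^+ e.
  by rewrite mulrAC -exprD -exprSr; congr (_ ^+ _); rewrite /e; lia.
by rewrite !exprS; field; rewrite !expf_neq0 // Q_neq0.
Qed.

(** By nodeB the differences of nodes factor into shifted factorials, so that
    the weight of a terminating very-well-poised series is the weight of a divided
    difference at the nodes. *)
Lemma node_prod N k : (k <= N)%N ->
  \prod_(j < N.+1 | j != k :> nat) (node k - node j) *
    ((1 - A * Q ^+ (2 * k)) * qpoch A Q k * qpoch (Q ^- N) Q k * Q ^+ (N * k)) =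
  qpoch Q Q N * \prod_(0 <= j < N) (- Q ^- j.+1) * qpoch A Q N.+1 *
    (qpoch Q Q k * qpoch (A * Q ^+ N.+1) Q k).
Proof.
move=> lekN; rewrite (prod_neq_ord (fun j => node k - node j)) //.
have -> : \prod_(j < k) (node k - node j) =
    Q ^- (k * k) * (qpoch Q Q k * qpoch (A * Q ^+ k) Q k).
  rewrite /qpoch [\prod_(i < k) (1 - Q * _)](reindex_inj rev_ord_inj) /=.
  rewrite exprM -exprVn -[X in _ ^+ X](card_ord k) -prodr_const -!big_split /=.
  apply: eq_bigr => j _; have ltjk := ltn_ord j.
  rewrite -{1}(subnKC (ltnW ltjk)) nodeB subnKC 1?ltnW //.
  by rewrite -exprS subnSK // (addnC j) exprD mulrA.
have -> : \prod_(j < N - k) (node k - node (k.+1 + j)) =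
    \prod_(k <= j < N) (- Q ^- j.+1) *
    (qpoch Q Q (N - k) * qpoch (A * Q ^+ k.*2.+1) Q (N - k)).
  have -> : \prod_(k <= j < N) (- Q ^- j.+1) = \prod_(j < N - k) (- Q ^- (j + k).+1).
    by rewrite -{1}[k]add0n big_addn big_mkord.
  rewrite -!big_split /=.
  apply: eq_bigr => j _; rewrite -opprB addSnnS nodeB -exprS -mulNr.
  rewrite addnS (addnC j) -mulrA -exprD.
  by have -> : (k + (k + j).+1 = k.*2.+1 + j)%N by lia.
have qA : qpoch A Q k * qpoch (A * Q ^+ k) Q k * (1 - A * Q ^+ (2 * k)) *
    qpoch (A * Q ^+ k.*2.+1) Q (N - k) =
    qpoch A Q N.+1 * qpoch (A * Q ^+ N.+1) Q k.
  rewrite -!qpochD addnn mul2n -qpochS -qpochD; congr (qpoch _ _ _); lia.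
have QkN : Q ^+ (N * k) = Q ^+ (k * k) * Q ^+ (k * (N - k)).
  by rewrite -exprD -mulnDr subnKC // mulnC.
have Qkk : Q ^- (k * k) * Q ^+ (k * k) = 1 by rewrite mulVf ?expf_neq0.
rewrite -(qpoch_compl lekN) QkN.
set V := \prod_(k <= j < N) (- Q ^- j.+1).
transitivity (Q ^- (k * k) * Q ^+ (k * k) *
  (qpoch Q Q (N - k) * qpoch (Q ^- N) Q k * (Q ^+ (k * (N - k)) * V)) *
  qpoch Q Q k * (qpoch A Q k * qpoch (A * Q ^+ k) Q k *
    (1 - A * Q ^+ (2 * k)) * qpoch (A * Q ^+ k.*2.+1) Q (N - k))); first by ring.
by rewrite qA Qkk mul1r; ring.
Qed.

(** Up to the factor z^M with z = Q^k, these are the Laurent polynomials in z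
    of degree at most M that are invariant under z -> 1 / (A z). *)
Definition sympoly M (f : nat -> K) :=
  exists2 p : {poly K}, (size p <= M.+1)%N
    & forall k, f k = Q ^+ (k * M) * p.[node k].

Lemma eq_sympoly M f g : f =1 g -> sympoly M f -> sympoly M g.
Proof. by move=> fg [p sz_p fE]; exists p => // k; rewrite -fg. Qed.

Lemma sympoly_const c : sympoly 0 (fun=> c).
Proof.
by exists c%:P => [|k]; rewrite ?size_polyC ?leq_b1 // muln0 mul1r hornerC.
Qed.

Lemma sympolyM M1 M2 f g :
  sympoly M1 f -> sympoly M2 g -> sympoly (M1 + M2) (fun k => f k * g k).
Proof.
move=> [p sz_p fE] [p' sz_p' gE]; exists (p * p') => [|k].
  apply: leq_trans (size_polyMleq _ _) _.
  by have := leq_add sz_p sz_p'; lia.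
by rewrite fE gE hornerM mulnDr exprD mulrACA.
Qed.

Lemma sympoly_prod M m (f : nat -> nat -> K) :
    (forall i, (i < m)%N -> sympoly M (f i)) ->
  sympoly (m * M) (fun k => \prod_(i < m) f i k).
Proof.
elim: m => [|m IHm] Hf.
  by apply: eq_sympoly (sympoly_const 1) => k; rewrite big_ord0.
rewrite mulSnr; have := sympolyM (IHm (fun i lti => Hf i (leqW lti))) (Hf m (ltnSn m)).
by apply: eq_sympoly => k; rewrite big_ord_recr.
Qed.

(** Divided by z, the product is z^-1 + A z - (b + c). *)
Lemma sympoly_lin b c : b * c = A ->
  sympoly 1 (fun k => (1 - b * Q ^+ k) * (1 - c * Q ^+ k)).
Proof.
move=> bc; exists ('X - (b + c)%:P) => [|k]; first by rewrite size_XsubC.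
by rewrite hornerXsubC /node -bc muln1; field; rewrite expf_neq0.
Qed.

(** The factor of index i on the left and the factor of index r - 1 - i on the
    right have parameters with product A. *)
Lemma sympoly_qpoch2 b c r : b * c * Q ^+ r = A * Q ->
  sympoly r (fun k => qpoch (b * Q ^+ k) Q r * qpoch (c * Q ^+ k) Q r).
Proof.
move=> bc; rewrite -[r in sympoly r]muln1.
pose f i k := (1 - b * Q ^+ i * Q ^+ k) * (1 - c * Q ^+ (r - i.+1) * Q ^+ k).
apply: (@eq_sympoly _ (fun k => \prod_(i < r) f i k)) => [k|].
  rewrite /qpoch [X in _ = _ * X](reindex_inj rev_ord_inj) -big_split /=.
  by apply: eq_bigr => i _; rewrite /f !(mulrAC _ (Q ^+ k)).
apply: sympoly_prod => i lti; apply: sympoly_lin; apply: (mulIf Q_neq0).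
by rewrite -bc -[in RHS](subnKC lti) exprD exprS; ring.
Qed.

(** Both sides of the cross-multiplied identity are (b; Q)_(k+r). This turns a
    quotient with k factors into a polynomial of degree r in Q^k. *)
Lemma qpoch_shift b r k : qpoch b Q k != 0 -> qpoch b Q r != 0 ->
  qpoch (b * Q ^+ r) Q k / qpoch b Q k = qpoch (b * Q ^+ k) Q r / qpoch b Q r.
Proof.
move=> bk br; apply/eqP; rewrite eqr_div // mulrC -qpochD addnC qpochD.
by rewrite mulrC.
Qed.

Lemma sympoly_pair b c r : b * c * Q ^+ r = A * Q ->
    (forall k, qpoch b Q k != 0) -> (forall k, qpoch c Q k != 0) ->
  sympoly r (fun k => qpoch (b * Q ^+ r) Q k / qpoch b Q k *
                      (qpoch (c * Q ^+ r) Q k / qpoch c Q k)).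
Proof.
move=> bc nb nc; rewrite -[r in sympoly r]addn0.
apply: eq_sympoly (sympolyM (sympoly_qpoch2 bc)
  (sympoly_const (qpoch b Q r * qpoch c Q r)^-1)) => k.
by rewrite (qpoch_shift (nb k)) // (qpoch_shift (nc k)) // invfM mulrACA.
Qed.

(** The factor matched with itself: the two halves of (b Q^k; Q)_(2r) are
    mirror images of each other. *)
Lemma sympoly_single b r : b * b * Q ^+ (r + r) = A * Q ->
    (forall k, qpoch b Q k != 0) ->
  sympoly r (fun k => qpoch (b * Q ^+ (r + r)) Q k / qpoch b Q k).
Proof.
move=> bb nb; rewrite -[r in sympoly r]addn0.
have bc : b * (b * Q ^+ r) * Q ^+ r = A * Q by rewrite -bb exprD; ring.
apply: eq_sympoly (sympolyM (sympoly_qpoch2 bc)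
  (sympoly_const (qpoch b Q (r + r))^-1)) => k.
by rewrite (qpoch_shift (nb k)) // [qpoch (b * _) Q (r + r)]qpochD (mulrAC b).
Qed.

(** The powers of Q^k combine to Q^(N k), as node_prod requires, and the sum is
    a divided difference of order N of a polynomial of degree M < N. *)
Lemma sum_sympoly_eq0 N M f :
    (forall s, (0 < s)%N -> Q ^+ s != 1) -> (forall s, A * Q ^+ s != 1) ->
    (M < N)%N -> sympoly M f ->
  \sum_(k < N.+1) (1 - A * Q ^+ (2 * k)) * qpoch A Q k * qpoch (Q ^- N) Q k /
    (qpoch Q Q k * qpoch (A * Q ^+ N.+1) Q k) * (Q ^+ ((N - M) * k) * f k) = 0.
Proof.
move=> nQ nA ltMN [p sz_p fE].
set C := qpoch Q Q N * \prod_(0 <= j < N) (- Q ^- j.+1) * qpoch A Q N.+1.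
transitivity (C * \sum_(k < N.+1)
    p.[node k] / \prod_(j < N.+1 | j != k) (node k - node j)); last first.
  rewrite sum_divided_difference ?mulr0 //; last exact: leq_trans ltMN.
  exact: node_inj.
rewrite mulr_sumr; apply: eq_bigr => k _.
have D_neq0 : \prod_(j < N.+1 | j != k) (node k - node j) != 0.
  apply/prodf_neq0 => j neq_jk; rewrite subr_eq0.
  by apply: contraNneq neq_jk => /(node_inj nQ nA) /ord_inj ->.
have q_neq0 : qpoch Q Q k * qpoch (A * Q ^+ N.+1) Q k != 0.
  apply: mulf_neq0; apply: qpoch_neq0 => s _; first by rewrite -exprS nQ.
  by rewrite -mulrA -exprD nA.
have := node_prod (ltn_ord k : (k <= N)%N); rewrite -/C fE.
have -> : (N * k = (N - M) * k + k * M)%N.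
  by rewrite (mulnC k) -mulnDl subnK // ltnW.
set D := \prod_(j < _ | _) _ in D_neq0 *.
rewrite exprD => /esym/(canRL (mulfK q_neq0)) ->.
set u := qpoch Q Q k * _ in q_neq0 *.
by field; rewrite D_neq0.
Qed.

End Nodes.

(** The numerators of a^(2i+3) and of a^(-(2i+1)) exceed the denominators of each
    other by the factor Q^(2r), as a^2 q = Q^(2r+1); the numerator of a exceeds
    its own denominator by the same factor. There remain the factor of
    a^(-(2h+1)), which is (Q^-N; Q)_k / (q Q^(N+1); Q)_k, and the factor of 1:
    they form the weight of sum_sympoly_eq0. The degree of the matched part is
    r + 2rh = N - h, so the exponent h k of Q is the required one. *)
Lemma sum_wpterm_terminating h r N a q :
    (0 < h)%N -> (N = r * h.*2.+1 + h)%N ->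
    (forall s, (0 < s)%N -> q ^+ s != 1) ->
    (forall n, generic h.+1 n a q (q ^+ h.+1.*2.+1)) ->
    a ^+ 2 * q = q ^+ h.+1.*2.+1 ^+ (r + r).+1 ->
    a ^+ h.*2.+1 = q * q ^+ h.+1.*2.+1 ^+ N ->
  \sum_(k < N.+1) wpterm h.+1 a q (q ^+ h.+1.*2.+1) k = 0.
Proof.
move=> h_gt0 defN nq gen a2 aN; set Q := q ^+ h.+1.*2.+1 in gen a2 aN *.
have [a_neq0 q_neq0 _ _ _] := gen 0.
have Q_neq0 : Q != 0 by rewrite expf_neq0.
have nQ s : (0 < s)%N -> Q ^+ s != 1 by move=> s_gt0; rewrite -exprM nq // muln_gt0.
have nA s : q * Q ^+ s != 1 by rewrite -exprM -exprS nq.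
have na i k : (i <= h)%N -> qpoch (a ^+ (2 * i).+1 * Q) Q k != 0.
  move=> lei; apply: qpoch_neq0 => s _; rewrite -mulrA -exprS.
  by have [_ _ _ _ /(_ i s.+1 lei (ltnSn _)) /andP[]] := gen s.+2.
have naV i k : (i <= h)%N -> qpoch (a ^- (2 * i).+1 * Q) Q k != 0.
  move=> lei; apply: qpoch_neq0 => s _; rewrite -mulrA -exprS.
  by have [_ _ _ _ /(_ i s.+1 lei (ltnSn _)) /andP[]] := gen s.+2.
pose f k := wpfac q Q a k * \prod_(i < h)
  (wpfac q Q (a ^+ (2 * i.+1).+1) k * wpfac q Q (a ^- (2 * i).+1) k).
have sym_f : sympoly q Q (r + h * (r + r)) f.
  apply: sympolyM => //.
    have aq : a * q = a^-1 * Q * Q ^+ (r + r).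
      by rewrite -mulrA -exprS -a2; field.
    apply: (@eq_sympoly _ _ _ (fun k =>
        qpoch (a^-1 * Q * Q ^+ (r + r)) Q k / qpoch (a^-1 * Q) Q k)) => [k|].
      by rewrite -aq.
    apply: sympoly_single => // [|k]; last exact: (naV 0).
    by rewrite -[LHS]mulrA -aq; field.
  apply: (@sympoly_prod _ _ Q_neq0 _ _ (fun i k =>
    wpfac q Q (a ^+ (2 * i.+1).+1) k * wpfac q Q (a ^- (2 * i).+1) k)) => i lti.
  have aq1 : a ^+ (2 * i.+1).+1 * q = a ^+ (2 * i).+1 * Q * Q ^+ (r + r).
    by rewrite -mulrA -exprS -a2 mulrA -exprD; congr (a ^+ _ * _); lia.
  have aq2 : a ^- (2 * i).+1 * q = a ^- (2 * i.+1).+1 * Q * Q ^+ (r + r).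
    rewrite -mulrA -exprS -a2 (_ : (2 * i.+1).+1 = ((2 * i).+1 + 2)%N) ?exprD; last lia.
    by field; rewrite expf_neq0 // a_neq0.
  apply: (@eq_sympoly _ _ _ (fun k =>
      qpoch (a ^+ (2 * i).+1 * Q * Q ^+ (r + r)) Q k /
        qpoch (a ^+ (2 * i).+1 * Q) Q k *
      (qpoch (a ^- (2 * i.+1).+1 * Q * Q ^+ (r + r)) Q k /
        qpoch (a ^- (2 * i.+1).+1 * Q) Q k))) => [k|].
    by rewrite /wpfac invrK aq1 aq2; ring.
  apply: sympoly_pair => // [|k|k]; last 2 first.
  - by apply: na; lia.
  - by apply: naV; lia.
  rewrite -mulrA -aq2; field; rewrite expf_neq0 //.
have ltMN : (r + h * (r + r) < N)%N by rewrite defN; lia.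
have := sum_sympoly_eq0 Q_neq0 nQ nA ltMN sym_f.
have -> : (N - (r + h * (r + r)) = h)%N by rewrite defN; lia.
move=> /(congr1 (fun S => S / (1 - q))); rewrite mul0r => S0.
rewrite -[RHS]S0 mulr_suml; apply: eq_bigr => k _.
have wpprodE : wpprod h.+1 a q Q k = f k * wpfac q Q (a ^- (2 * h).+1) k.
  rewrite /wpprod [LHS]big_split /= big_ord_recl big_ord_recr /f.
  by rewrite [in RHS]big_split /= muln0 expr1 !mulrA.
have single1 : wpfac q Q 1 k = qpoch q Q k / qpoch Q Q k.
  by rewrite /wpfac invr1 !mul1r.
have single_last : wpfac q Q (a ^- (2 * h).+1) k =
    qpoch (Q ^- N) Q k / qpoch (q * Q ^+ N.+1) Q k.
  rewrite /wpfac invrK mul2n aN -mulrA -exprSr invfM mulrAC mulVf //.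
  by rewrite mul1r.
rewrite /wpterm wpprodE single1 single_last [(h * k)%N]mulnC invfM /=; ring.
Qed.

End Terminating.

(** * Simultaneous specialization of rational functions *)

Section Specialization.
Variables (I : Type) (K : fieldType) (f : I -> {rmorphism polyaq -> K}).
Variable i0 : I.
Implicit Types (A B : ratfunaq) (y z : I -> K).

(** The value of a rational function at the points f i. The denominator V is
    the same for all points, because the congruence modulo a product of primes
    needs one denominator that is prime to all of them. *)
Definition specializes A y := exists U V : polyaq,
  [/\ forall i, f i V != 0, A = U%:F / V%:F & forall i, y i = f i U / f i V].

Lemma specializes_den_neq0 (V : polyaq) : (forall i, f i V != 0) -> V%:F != 0.
Proof.
move=> /(_ i0); apply: contraNneq => /eqP; rewrite tofrac_eq0 => /eqP ->.
by rewrite rmorph0.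
Qed.

Lemma eq_specializes A y z : y =1 z -> specializes A y -> specializes A z.
Proof. by move=> yz [U [V [nV AE yE]]]; exists U, V; split=> // i; rewrite -yz. Qed.

Lemma specializes_poly (p : polyaq) : specializes p%:F (fun i => f i p).
Proof.
exists p, 1; split=> [i||i]; rewrite !rmorph1 ?oner_eq0 ?divr1 //.
Qed.

Lemma specializesD A B y z :
  specializes A y -> specializes B z -> specializes (A + B) (fun i => y i + z i).
Proof.
move=> [U [V [nV -> yE]]] [U' [V' [nV' -> zE]]].
have V0 := specializes_den_neq0 nV; have V0' := specializes_den_neq0 nV'.
exists (U * V' + U' * V), (V * V'); split=> [i||i].
- by rewrite rmorphM mulf_neq0.
- by rewrite (addf_div _ _ V0 V0') tofracD !tofracM.
- by rewrite yE zE addf_div // !(rmorphD, rmorphM).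
Qed.

Lemma specializesM A B y z :
  specializes A y -> specializes B z -> specializes (A * B) (fun i => y i * z i).
Proof.
move=> [U [V [nV -> yE]]] [U' [V' [nV' -> zE]]].
exists (U * U'), (V * V'); split=> [i||i].
- by rewrite rmorphM mulf_neq0.
- by rewrite mulf_div !tofracM.
- by rewrite yE zE mulf_div !rmorphM.
Qed.

Lemma specializesV A y : (forall i, y i != 0) ->
  specializes A y -> specializes A^-1 (fun i => (y i)^-1).
Proof.
move=> ny [U [V [nV -> yE]]]; exists V, U; split=> [i||i].
- by apply: contraNneq (ny i) => U0; rewrite yE U0 mul0r.
- by rewrite invf_div.
- by rewrite yE invf_div.
Qed.

Lemma specializesX A y n : specializes A y -> specializes (A ^+ n) (fun i => y i ^+ n).
Proof.
move=> Ay; elim: n => [|n IHn].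
  apply: eq_specializes (specializes_poly 1) => i; exact: rmorph1.
by rewrite exprS; apply: eq_specializes (specializesM Ay IHn) => i; rewrite exprS.
Qed.

Lemma specializes_1sub A y : specializes A y -> specializes (1 - A) (fun i => 1 - y i).
Proof.
move=> Ay.
have := specializesD (specializes_poly 1) (specializesM (specializes_poly (-1)) Ay).
rewrite rmorphN1 rmorph1 mulN1r; apply: eq_specializes => i.
by rewrite rmorphN1 rmorph1 mulN1r.
Qed.

Lemma specializes_prod n (F : nat -> ratfunaq) (G : nat -> I -> K) :
  (forall j, (j < n)%N -> specializes (F j) (G j)) ->
  specializes (\prod_(j < n) F j) (fun i => \prod_(j < n) G j i).
Proof.
elim: n => [|n IHn] FG.
  rewrite big_ord0; apply: eq_specializes (specializes_poly 1) => i.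
  by rewrite big_ord0 rmorph1.
rewrite big_ord_recr; have FGn := FG n (ltnSn n).
apply: eq_specializes (specializesM (IHn (fun j ltj => FG j (leqW ltj))) FGn) => i.
by rewrite big_ord_recr.
Qed.

Lemma specializes_sum n (F : nat -> ratfunaq) (G : nat -> I -> K) :
  (forall j, (j < n)%N -> specializes (F j) (G j)) ->
  specializes (\sum_(0 <= j < n) F j) (fun i => \sum_(0 <= j < n) G j i).
Proof.
elim: n => [|n IHn] FG.
  rewrite big_geq //; apply: eq_specializes (specializes_poly 0) => i.
  by rewrite big_geq // rmorph0.
rewrite big_nat_recr //; have FGn := FG n (ltnSn n).
apply: eq_specializes (specializesD (IHn (fun j ltj => FG j (leqW ltj))) FGn) => i.
by rewrite big_nat_recr.
Qed.

Lemma specializes_qpoch A B y z k : specializes A y -> specializes B z ->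
  specializes (qpoch A B k) (fun i => qpoch (y i) (z i) k).
Proof.
move=> Ay Bz; apply: (specializes_prod (F := fun j => 1 - A * B ^+ j)
  (G := fun j i => 1 - y i * z i ^+ j)) => j _.
exact/specializes_1sub/specializesM/specializesX.
Qed.

Lemma specializes_wpfac C A B w y z k :
    (forall i, w i != 0) -> (forall i, qpoch ((w i)^-1 * z i) (z i) k != 0) ->
    specializes C w -> specializes A y -> specializes B z ->
  specializes (wpfac A B C k) (fun i => wpfac (y i) (z i) (w i) k).
Proof.
move=> nw nden Cw Ay Bz; apply: specializesM.
  exact/specializes_qpoch/Bz/specializesM.
apply: specializesV => //; apply: specializes_qpoch (Bz).
exact/specializesM/Bz/specializesV.
Qed.

Lemma specializes_wpterm h n k : (k < n)%N ->
    (forall i, generic h n (f i polya) (f i polyq) (f i polyq ^+ h.*2.+1)) ->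
  specializes (wpterm h inda indq (indq ^+ h.*2.+1) k)
    (fun i => wpterm h (f i polya) (f i polyq) (f i polyq ^+ h.*2.+1) k).
Proof.
move=> ltkn gen.
have qS := specializes_poly polyq; have aS := specializes_poly polya.
have QS := specializesX h.*2.+1 qS.
have nden i b : b != 0 ->
    (forall s, (0 < s < n)%N -> b^-1 * (f i polyq ^+ h.*2.+1) ^+ s != 1) ->
    qpoch (b^-1 * f i polyq ^+ h.*2.+1) (f i polyq ^+ h.*2.+1) k != 0.
  move=> b0 nb; apply: qpoch_neq0 => s lts; rewrite -mulrA -exprS nb //; lia.
apply: specializesM; last exact: specializesX.
apply: specializesM.
  apply: specializesM.
    apply: specializesM; first exact/specializes_1sub/specializesM/specializesX.
    apply: specializesV (specializes_1sub qS) => i.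
    by have [_ _ q1 _ _] := gen i; rewrite subr_eq0 eq_sym.
  apply: specializes_wpfac => //.
  - by move=> i; rewrite oner_eq0.
  - move=> i; apply: nden; first by rewrite oner_eq0.
    by move=> s lts; have [_ _ _ nQ _] := gen i; rewrite invr1 mul1r nQ.
  - by apply: eq_specializes (specializes_poly 1) => i; rewrite rmorph1.
apply: (specializes_prod
  (F := fun j => wpfac indq (indq ^+ h.*2.+1) (inda ^+ (2 * j).+1) k *
                 wpfac indq (indq ^+ h.*2.+1) (inda ^- (2 * j).+1) k)
  (G := fun j i =>
    wpfac (f i polyq) (f i polyq ^+ h.*2.+1) (f i polya ^+ (2 * j).+1) k *
    wpfac (f i polyq) (f i polyq ^+ h.*2.+1) (f i polya ^- (2 * j).+1) k)) => j ltj.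
have aj0 i : f i polya ^+ (2 * j).+1 != 0.
  by have [a0 _ _ _ _] := gen i; rewrite expf_neq0.
have ajS := specializesX (2 * j).+1 aS.
apply: specializesM.
  apply: specializes_wpfac => // i; apply: nden => // s lts.
  by have [_ _ _ _ /(_ j s ltj lts) /andP[]] := gen i.
apply: specializes_wpfac => //.
- by move=> i; rewrite invr_eq0.
- move=> i; apply: nden; first by rewrite invr_eq0.
  by move=> s lts; rewrite invrK; have [_ _ _ _ /(_ j s ltj lts) /andP[]] := gen i.
- exact: specializesV.
Qed.

Lemma specializes0 A : specializes A (fun=> 0) ->
  exists U V : polyaq, [/\ forall i, f i V != 0, forall i, f i U = 0 & A = U%:F / V%:F].
Proof.
move=> [U [V [nV -> yE]]]; exists U, V; split=> // i.
by apply/eqP; have /esym/eqP := yE i; rewrite mulf_eq0 invr_eq0 (negPf (nV i)) orbF.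
Qed.

End Specialization.

(** If p generates the kernel of a morphism to a field, then p is prime. The two
    lemmas of the section draw the consequences needed for products of such p. *)
Section PrimeFactors.
Variables (K : fieldType) (f : {rmorphism polyaq -> K}) (p : polyaq).
Hypothesis ker_f : forall x, f x = 0 -> dvdaq p x.

Lemma dvdaq_mul P x : f P != 0 -> dvdaq P x -> f x = 0 -> dvdaq (P * p) x.
Proof.
move=> nP [C ->] /eqP; rewrite rmorphM mulf_eq0 (negPf nP) => /eqP /ker_f [C' ->].
by exists C'; rewrite mulrA.
Qed.

Lemma relprimeaq_mul P V : p != 0 -> f p = 0 -> f V != 0 ->
  relprimeaq P V -> relprimeaq (P * p) V.
Proof.
move=> p0 fp nV coPV D [C PpE] [C' VE]; apply: coPV; last by exists C'.
have nD : f D != 0 by apply: contraNneq nV => D0; rewrite VE rmorphM D0 mul0r.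
have /eqP : f (D * C) = 0 by rewrite -PpE rmorphM fp mulr0.
rewrite rmorphM mulf_eq0 (negPf nD) => /eqP /ker_f [C'' CE].
by exists C''; apply: (mulIf p0); rewrite PpE CE; ring.
Qed.

End PrimeFactors.

Lemma relprimeaq1 V : relprimeaq 1 V.
Proof. by move=> D [C DC] _; apply/unitrPr; exists C. Qed.

(** * The generic zeros of the three factors *)

(** The field of rational functions in t over the algebraic numbers: it contains
    a generic zero of each of the three factors of the modulus. *)
Definition ratfunC : fieldType := {fraction {poly algC}}.

Definition cstC (c : algC) : ratfunC := (c%:P)%:F.
Definition varC : ratfunC := ('X : {poly algC})%:F.

Definition iotaC : {rmorphism rat -> ratfunC} :=
  (@FracField.tofrac {poly algC} \o polyC) \o (@ratr algC).

Definition evq (kappa : ratfunC) : {rmorphism {poly rat} -> ratfunC} :=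
  horner_morph (fun c => mulrC kappa (iotaC c)).

Definition evaq (alpha kappa : ratfunC) : {rmorphism polyaq -> ratfunC} :=
  horner_morph (fun c => mulrC alpha (evq kappa c)).

Lemma evaq_polya alpha kappa : evaq alpha kappa polya = alpha.
Proof. exact: horner_morphX. Qed.

Lemma evaqC alpha kappa c : evaq alpha kappa c%:P = evq kappa c.
Proof. exact: horner_morphC. Qed.

Lemma evaq_polyq alpha kappa : evaq alpha kappa polyq = kappa.
Proof. rewrite evaqC; exact: horner_morphX. Qed.

Lemma evq_comp (k : {poly algC}) p : evq k%:F p = (map_poly ratr p \Po k)%:F.
Proof.
rewrite /= /horner_morph map_poly_comp map_poly_comp horner_map.
by congr (_%:F).
Qed.

Lemma evq_varC_inj : injective (evq varC).
Proof.
move=> p p'; rewrite !evq_comp !comp_polyXr => /eqP; rewrite tofrac_eq => /eqP.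
exact: map_poly_inj.
Qed.

(** The factor theorem in the variable a, since the coefficients of x embed into
    the rational functions in t. *)
Lemma dvdaq_power n x : evaq (varC ^+ n) varC x = 0 ->
  dvdaq (polya - polyq ^+ n) x.
Proof.
move=> x0.
have evqXn : evq varC 'X^n = varC ^+ n.
  by rewrite rmorphXn; congr (_ ^+ _); exact: horner_morphX.
have : x.['X^n] = 0.
  apply: evq_varC_inj; rewrite rmorph0 -x0 -evqXn; exact/esym/horner_map.
move/eqP/factor_theorem => [C ->]; exists C.
by rewrite mulrC /polya /polyq -rmorphXn.
Qed.

(** The leading coefficient of 1 - a q^n is not a unit, so the division proceeds
    from the lowest degree: if x = p a + c, then x is congruent to
    a (p + c q^n) modulo 1 - a q^n, and p + c q^n has smaller degree in a and the
    same zero. *)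
Lemma dvdaq_inverse_power n x : evaq (varC ^- n) varC x = 0 ->
  dvdaq (1 - polya * polyq ^+ n) x.
Proof.
have t_neq0 : varC ^+ n != 0 by rewrite expf_neq0 // tofrac_eq0 polyX_eq0.
have [m] := ubnP (size x); elim: m x => // m IHm x.
elim/poly_ind: x => [|p c _] lexm x0; first by exists 0; rewrite mulr0.
have [p0|p_neq0] := eqVneq p 0.
  have c0 : c = 0.
    by apply: evq_varC_inj; rewrite rmorph0 -x0 p0 mul0r add0r evaqC.
  by exists 0; rewrite p0 c0 mulr0 mul0r addr0.
have [||C yE] := IHm (p + (c * 'X^n)%:P).
- rewrite -ltnS; apply: leq_trans lexm; rewrite size_MXaddC (negPf p_neq0) /= ltnS ltnS.
  apply: leq_trans (size_polyD _ _) _; rewrite geq_max leqnn /=.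
  by apply: leq_trans (size_polyC_leq1 _) _; rewrite size_poly_gt0.
- move: x0; rewrite !rmorphD !rmorphM /= -/polya evaq_polya !evaqC.
  have -> : evq varC 'X^n = varC ^+ n.
    by rewrite rmorphXn; congr (_ ^+ _); exact: horner_morphX.
  move=> /(congr1 (fun u => u * varC ^+ n)).
  by rewrite mul0r mulrDl mulfVK.
exists (polya * C + c%:P); rewrite mulrDr mulrCA -yE /polya /polyq -rmorphXn rmorphM /=.
ring.
Qed.

(** The cyclotomic polynomial is the minimal polynomial of z over the
    rationals. *)
Lemma cyclotomic_rat n z : n.-primitive_root z -> forall p : {poly rat},
  root (map_poly (ratr : rat -> algC) p) z =
  (map_poly (intr : int -> rat) 'Phi_n %| p).
Proof.
move=> prim_z p; have [m [mE m_monic mP]] := minCpolyP z.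
suff -> : map_poly (intr : int -> rat) 'Phi_n = m by rewrite mP.
apply: (map_inj_poly (fmorph_inj (@ratr algC))); rewrite ?rmorph0 //.
rewrite -mE (minCpoly_cyclotomic prim_z) -(Cintr_Cyclotomic prim_z) -map_poly_comp.
by apply: eq_map_poly => c /=; rewrite ratr_int.
Qed.

Lemma evq_cstC z p : evq (cstC z) p = ((map_poly ratr p).[z])%:P%:F.
Proof. by rewrite evq_comp /comp_poly horner_map. Qed.

(** As t is transcendental over the algebraic numbers, all the coefficients of
    x as a polynomial in a vanish at z. *)
Lemma dvdaq_cyclotomic n z x : n.-primitive_root z ->
  evaq varC (cstC z) x = 0 -> dvdaq (polyPhi n) x.
Proof.
move=> prim_z x0; set Phi := map_poly (intr : int -> rat) 'Phi_n.
pose evz : {rmorphism {poly rat} -> algC} :=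
  horner_morph (fun c => mulrC z (ratr c)).
have evxE : evaq varC (cstC z) x = (map_poly evz x)%:F.
  transitivity (map_poly ((@FracField.tofrac {poly algC} \o polyC) \o evz) x).[varC].
    by congr (_.[_]); apply: eq_map_poly => p; exact: evq_cstC.
  rewrite map_poly_comp map_poly_comp horner_map; congr (_%:F).
  exact: comp_polyXr.
have x_i i : Phi %| x`_i.
  rewrite -(cyclotomic_rat prim_z); apply/eqP.
  move/eqP: x0; rewrite evxE tofrac_eq0 => /eqP evx0.
  by have := congr1 (fun p : {poly algC} => p`_i) evx0; rewrite /= coef0 coef_map.
exists (map_poly (fun p => p %/ Phi) x); rewrite /polyPhi -/Phi.
apply/polyP => i; rewrite coefCM coef_map_id0 ?div0p //.
by rewrite mulrC divpK.
Qed.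

Lemma evaq_polyPhi n z alpha : n.-primitive_root z ->
  evaq alpha (cstC z) (polyPhi n) = 0.
Proof.
move=> prim_z; rewrite evaqC evq_cstC.
have := cyclotomic_rat prim_z (map_poly intr 'Phi_n); rewrite dvdpp => /eqP ->.
by rewrite !rmorph0.
Qed.

Lemma polyPhi_neq0 n : map_poly (intr : int -> rat) 'Phi_n != 0.
Proof. by rewrite monic_neq0 // monic_map // Cyclotomic_monic. Qed.

Lemma generic_inv (K : fieldType) h n (a q Q : K) :
  generic h n a q Q -> generic h n a^-1 q Q.
Proof.
move=> [a0 q0 q1 nQ na]; split=> // [|i s lti lts]; first by rewrite invr_eq0.
by rewrite -exprVn invrK exprVn andbC na.
Qed.

Lemma wpterm_inv (K : fieldType) h (a q Q : K) k :
  wpterm h a^-1 q Q k = wpterm h a q Q k.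
Proof.
rewrite /wpterm /wpprod; congr (_ * _ * _); apply: eq_bigr => i _.
by rewrite -exprVn invrK exprVn mulrC.
Qed.

Lemma varC_neq0 : varC != 0.
Proof. by rewrite tofrac_eq0 polyX_eq0. Qed.

Lemma varC_exp_neq0 m : varC ^+ m != 0.
Proof. exact/expf_neq0/varC_neq0. Qed.

Lemma varC_exp_inj m l : varC ^+ m = varC ^+ l -> m = l.
Proof.
rewrite /varC -!tofracXn => /eqP; rewrite tofrac_eq => /eqP /(congr1 (size \o polyseq)).
by rewrite /= !size_polyXn => -[].
Qed.

Lemma varC_exp_neq1 m : (0 < m)%N -> varC ^+ m != 1.
Proof.
move=> m_gt0; apply: contraTneq m_gt0.
by rewrite -[1](expr0 varC) => /varC_exp_inj ->.
Qed.

Lemma cstCX z m : cstC z ^+ m = cstC (z ^+ m).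
Proof. by rewrite /cstC -tofracXn -polyC_exp. Qed.

Lemma cstC_inj : injective cstC.
Proof. by move=> z z' /eqP; rewrite tofrac_eq => /eqP /polyC_inj. Qed.

Lemma varC_exp_neq_cstC m z : (0 < m)%N -> varC ^+ m != cstC z.
Proof.
move=> m_gt0; rewrite /varC /cstC -tofracXn tofrac_eq.
apply/eqP => /(congr1 (size \o polyseq)) /=.
by rewrite size_polyXn size_polyC; case: eqP; lia.
Qed.

Lemma generic_prim_root h n z : n.-primitive_root z -> (1 < n)%N ->
  coprime n h.*2.+1 -> generic h n varC (cstC z) (cstC z ^+ h.*2.+1).
Proof.
move=> prim_z n_gt1 co_nd.
have z_neq0 m : z ^+ m != 0 by rewrite expf_neq0 // (prim_root_eq0 prim_z) -lt0n ltnW.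
have cst1 : cstC 1 = 1 by rewrite /cstC !rmorph1.
split=> [|||s lts|i s lti lts].
- exact: varC_neq0.
- by rewrite -[z]expr1 tofrac_eq0 polyC_eq0.
- rewrite -cst1 (inj_eq cstC_inj) -[z]expr1 -(prim_order_dvd prim_z) dvdn1.
  by rewrite neq_ltn n_gt1 orbT.
- rewrite -exprM cstCX -cst1 (inj_eq cstC_inj) -(prim_order_dvd prim_z).
  rewrite Gauss_dvdr //; apply/negP => /dvdn_leq; lia.
rewrite -exprM cstCX; set c := z ^+ _; have c_neq0 : c != 0 by apply: z_neq0.
have cC_neq0 : cstC c != 0 by rewrite tofrac_eq0 polyC_eq0.
apply/andP; split.
  apply: contraNneq (varC_exp_neq_cstC c^-1 (ltn0Sn (2 * i))) => vc1.
  apply/eqP/(mulIf cC_neq0).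
  by rewrite vc1 -cst1 /cstC -tofracM -polyCM mulVf.
apply: contraNneq (varC_exp_neq_cstC c (ltn0Sn (2 * i))) => vc1.
have v_neq0 := varC_exp_neq0 (2 * i).+1.
by rewrite -[X in _ == X](mulVKf v_neq0) vc1 mulr1.
Qed.

(** An exponent of t can only vanish if d s = (2i+1) n, which is impossible: d is
    prime to n and 2i+1 < d. *)
Lemma generic_power h n m : coprime n h.*2.+1 ->
  generic h m (varC ^+ n) varC (varC ^+ h.*2.+1).
Proof.
move=> co_nd; split=> [|||s lts|i s lti lts].
- exact: varC_exp_neq0.
- exact: varC_neq0.
- by rewrite -[varC]expr1 varC_exp_neq1.
- by rewrite -exprM varC_exp_neq1 // muln_gt0; lia.
rewrite -!exprM; apply/andP; split.
  by rewrite -exprD varC_exp_neq1 // addn_gt0 !muln_gt0; lia.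
have v_neq0 := varC_exp_neq0 (n * (2 * i).+1).
rewrite -(inj_eq (mulfI v_neq0)) mulVKf // mulr1.
apply/eqP => /varC_exp_inj E.
have : (h.*2.+1 %| n * (2 * i).+1)%N by rewrite -E dvdn_mulr.
by rewrite Gauss_dvdr 1?coprime_sym // => /dvdn_leq; lia.
Qed.

Lemma two_neq0_ratfunC : 2 != 0 :> ratfunC.
Proof.
rewrite -(rmorph_nat (@FracField.tofrac {poly algC})) tofrac_eq0.
by rewrite -polyC_natr polyC_eq0 Num.Theory.pnatr_eq0.
Qed.

(** The factor of a^(-(2h+1)) has the numerator (Q^-N; Q)_k, which vanishes for
    k > N. *)
Lemma sum_wpterm_power (K : fieldType) h r n N (q : K) : (0 < h)%N ->
    n = (r * h.+1.*2.+1 + h.+1)%N -> N = (r * h.*2.+1 + h)%N ->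
    (forall s, (0 < s)%N -> q ^+ s != 1) ->
    (forall m, generic h.+1 m (q ^+ n) q (q ^+ h.+1.*2.+1)) ->
  \sum_(0 <= k < n) wpterm h.+1 (q ^+ n) q (q ^+ h.+1.*2.+1) k = 0.
Proof.
move=> h_gt0 nE NE nq gen; set Q := q ^+ h.+1.*2.+1 in gen *.
have [_ q_neq0 _ _ _] := gen 0.
have qQN_neq0 : q * Q ^+ N != 0 by rewrite mulf_neq0 ?expf_neq0.
have aN : (q ^+ n) ^+ h.*2.+1 = q * Q ^+ N.
  by rewrite -!exprM -exprS; congr (_ ^+ _); rewrite nE NE; lia.
have tail0 : \sum_(N.+1 <= k < n) wpterm h.+1 (q ^+ n) q Q k = 0.
  rewrite big_nat big1 // => k /andP[ltNk _].
  have last0 : wpfac q Q ((q ^+ n) ^- (2 * h).+1) k = 0.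
    rewrite /wpfac (@qpoch_eq0 _ _ _ N) ?mul0r //.
    by rewrite mul2n aN -mulrA mulVf.
  by rewrite /wpterm /wpprod (bigD1 ord_max) //= last0 mulr0 mul0r mulr0 mul0r.
rewrite (big_cat_nat (n := N.+1)) //=; last by rewrite nE NE; lia.
rewrite tail0 addr0 big_mkord; apply: sum_wpterm_terminating NE _ gen _ aN => //.
by rewrite -!exprM -exprSr; congr (_ ^+ _); rewrite nE; lia.
Qed.

Variant prime_factor := CyclotomicFactor | InversePowerFactor | PowerFactor.

Definition zero_of n z (i : prime_factor) : ratfunC * ratfunC :=
  match i with
  | CyclotomicFactor => (varC, cstC z)
  | InversePowerFactor => (varC ^- n, varC)
  | PowerFactor => (varC ^+ n, varC)
  end.

Definition eval_at n z (i : prime_factor) : {rmorphism polyaq -> ratfunC} :=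
  evaq (zero_of n z i).1 (zero_of n z i).2.

Lemma sum_wpterm_eval h r n z i : (0 < h)%N ->
    n = (r * h.+1.*2.+1 + h.+1)%N -> n.-primitive_root z ->
  let a := (zero_of n z i).1 in let q := (zero_of n z i).2 in
  generic h.+1 n a q (q ^+ h.+1.*2.+1) /\
  \sum_(0 <= k < n) wpterm h.+1 a q (q ^+ h.+1.*2.+1) k = 0.
Proof.
move=> h_gt0 nE prim_z.
(* d (2r + 1) - 2n = 1. *)
have co_nd : coprime n h.+1.*2.+1.
  have E : (n * 2 + 1 = h.+1.*2.+1 * r.*2.+1)%N by rewrite nE; lia.
  rewrite /coprime -dvdn1 -(@dvdn_addr (n * 2)) ?E.
    by rewrite dvdn_mulr // dvdn_gcdr.
  by rewrite dvdn_mulr // dvdn_gcdl.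
have n_gt1 : (1 < n)%N by rewrite nE; lia.
have genP m : generic h.+1 m (varC ^+ n) varC (varC ^+ h.+1.*2.+1).
  exact: generic_power.
pose N := (r * h.*2.+1 + h)%N.
have sumP := sum_wpterm_power h_gt0 nE (erefl N) varC_exp_neq1 genP.
case: i => /=; split.
- exact: generic_prim_root.
- apply: (@sum_wpterm_prim_root _ h.+1 n N _ _ two_neq0_ratfunC).
  + by [].
  + by rewrite nE /N; lia.
  + by rewrite nE /N; lia.
  + by rewrite (fmorph_primitive_root (@FracField.tofrac {poly algC} \o polyC)).
  + exact: generic_prim_root.
- exact/generic_inv/genP.
- by rewrite -[RHS]sumP; apply: eq_bigr => k _; exact: wpterm_inv.
- exact: genP.
- exact: sumP.
Qed.

Lemma eval_at_cyclotomic n z i : n.-primitive_root z ->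
  (eval_at n z i (polyPhi n) == 0) = if i is CyclotomicFactor then true else false.
Proof.
move=> prim_z; case: i; rewrite /eval_at /=.
- by rewrite evaq_polyPhi ?eqxx.
- by rewrite evaqC -(rmorph0 (evq varC)) (inj_eq evq_varC_inj) (negPf (polyPhi_neq0 n)).
- by rewrite evaqC -(rmorph0 (evq varC)) (inj_eq evq_varC_inj) (negPf (polyPhi_neq0 n)).
Qed.

Lemma eval_at_inverse_power n z i : n.-primitive_root z ->
  (eval_at n z i (1 - polya * polyq ^+ n) == 0) =
    if i is InversePowerFactor then true else false.
Proof.
move=> prim_z; have n_gt0 := prim_order_gt0 prim_z.
rewrite /eval_at rmorphB rmorph1 rmorphM rmorphXn evaq_polya evaq_polyq subr_eq0 eq_sym.
case: i => /=.
- rewrite cstCX (prim_expr_order prim_z) /cstC !rmorph1 mulr1.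
  by rewrite -[varC]expr1 (negPf (varC_exp_neq1 _)).
- by rewrite mulVf ?eqxx ?varC_exp_neq0.
- by rewrite -exprD (negPf (varC_exp_neq1 _)) // addn_gt0 n_gt0.
Qed.

Lemma eval_at_power n z i : n.-primitive_root z ->
  (eval_at n z i (polya - polyq ^+ n) == 0) = if i is PowerFactor then true else false.
Proof.
move=> prim_z; have n_gt0 := prim_order_gt0 prim_z.
rewrite /eval_at rmorphB rmorphXn evaq_polya evaq_polyq subr_eq0.
case: i => /=.
- rewrite cstCX (prim_expr_order prim_z) /cstC !rmorph1.
  by rewrite -[varC]expr1 (negPf (varC_exp_neq1 _)).
- rewrite -(inj_eq (mulfI (varC_exp_neq0 n))) mulfV ?varC_exp_neq0 // -exprD eq_sym.
  by rewrite (negPf (varC_exp_neq1 _)) // addn_gt0 n_gt0.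
- by rewrite eqxx.
Qed.

(** Both d and (2n + 1) / d are odd; write them as 2(h+1) + 1 and 2r + 1. *)
Lemma half_congruence d n : odd d -> (5 <= d)%N -> (2 * n%:Z = -1 %[mod d%:Z])%Z ->
  exists h r, [/\ (0 < h)%N, d = h.+1.*2.+1 & n = (r * h.+1.*2.+1 + h.+1)%N].
Proof.
move=> d_odd d_ge5 /eqP; rewrite eqz_mod_dvd opprK.
have -> : 2 * n%:Z + 1 = (2 * n + 1)%N%:Z by lia.
rewrite dvdzE /= => /dvdnP[m nE].
have m_odd : odd m.
  by have := congr1 odd nE; rewrite oddD !oddM /= d_odd andbT => <-.
exists d./2.-1, m./2; have := odd_double_half d; have := odd_double_half m.
rewrite m_odd d_odd /=; set r := m./2; set h := d./2 => mE dE.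
have h_ge2 : (2 <= h)%N by lia.
have dE' : d = h.-1.+1.*2.+1 by lia.
split; [lia | exact: dE' |].
by rewrite -dE'; lia.
Qed.

Theorem theorem6 (d n : nat) (hd : (5 <= d)%N) (hodd : odd d) (hn : (0 < n)%N)
    (hdn : (2 * n%:Z = -1 %[mod d%:Z])%Z) :
  congr0aq
    (\sum_(0 <= k < n)
       qint indq (2 * d * k + 1)%N%:Z *
       ((qpochs (pospows d inda indq) (indq ^+ d) k *
         qpochs (negpows d inda indq) (indq ^+ d) k *
         qpoch indq (indq ^+ d) k) /
        (qpochs (pospows d inda (indq ^+ d)) (indq ^+ d) k *
         qpochs (negpows d inda (indq ^+ d)) (indq ^+ d) k *
         qpoch (indq ^+ d) (indq ^+ d) k)) *
       indq ^+ (d * (d - 3) * k)./2)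
    (polyPhi n * (1 - polya * polyq ^+ n) * (polya - polyq ^+ n)).
Proof.
have [h [r [h_gt0 dE nE]]] := half_congruence hodd hd hdn.
have [z prim_z] := C_prim_root_exists hn.
pose f := eval_at n z.
have fa i : f i polya = (zero_of n z i).1 by exact: evaq_polya.
have fq i : f i polyq = (zero_of n z i).2 by exact: evaq_polyq.
have spec_sum : specializes f (\sum_(0 <= k < n) summand d inda indq k) (fun=> 0).
  rewrite dE; apply: eq_specializes (specializes_sum CyclotomicFactor
    (F := fun k => summand h.+1.*2.+1 inda indq k)
    (G := fun k i => wpterm h.+1 (f i polya) (f i polyq) (f i polyq ^+ h.+1.*2.+1) k) _).
    by move=> i; rewrite fa fq; have [_ ->] := sum_wpterm_eval i h_gt0 nE prim_z.
  move=> k ltkn; rewrite summandE //; apply: specializes_wpterm ltkn _ => [|i].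
    exact: CyclotomicFactor.
  by rewrite fa fq; have [] := sum_wpterm_eval i h_gt0 nE prim_z.
have [U [V [fV fU ->]]] := specializes0 spec_sum.
have kerPhi x : f CyclotomicFactor x = 0 -> dvdaq (polyPhi n) x.
  exact: dvdaq_cyclotomic.
have kerI x : f InversePowerFactor x = 0 -> dvdaq (1 - polya * polyq ^+ n) x.
  exact: dvdaq_inverse_power.
have kerP x : f PowerFactor x = 0 -> dvdaq (polya - polyq ^+ n) x.
  exact: dvdaq_power.
have [C UE] : dvdaq (polyPhi n * (1 - polya * polyq ^+ n) * (polya - polyq ^+ n)) U.
  apply: (dvdaq_mul kerP) (fU _).
    by rewrite rmorphM mulf_neq0 // ?eval_at_cyclotomic ?eval_at_inverse_power.
  apply: (dvdaq_mul kerI) (fU _); first by rewrite eval_at_cyclotomic.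
  exact/kerPhi/fU.
have neq0 i (x : polyaq) : f i x != 0 -> x != 0.
  by apply: contraNneq => ->; rewrite rmorph0.
exists C, V; split.
- exact: neq0 CyclotomicFactor _ (fV _).
- apply: (relprimeaq_mul kerP) (fV _) _.
  + by apply: (neq0 CyclotomicFactor); rewrite eval_at_power.
  + by apply/eqP; rewrite eval_at_power.
  apply: (relprimeaq_mul kerI) (fV _) _.
  + by apply: (neq0 CyclotomicFactor); rewrite eval_at_inverse_power.
  + by apply/eqP; rewrite eval_at_inverse_power.
  rewrite -[polyPhi n]mul1r; apply: (relprimeaq_mul kerPhi) (fV _) _.
  + by apply: (neq0 PowerFactor); rewrite eval_at_cyclotomic.
  + by apply/eqP; rewrite eval_at_cyclotomic.
  exact: relprimeaq1.
- by rewrite UE.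
Qed.
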